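(* For any finite set $X$, $$\mathcal{R}\text{-}\mathrm{Geo}(\mathrm{FIM}_X)=\mathcal{L}\text{-}\mathrm{Geo}(\mathrm{FIM}_X)^{-1}.$$
   Context: $\mathrm{FIM}_X$ is the free inverse monoid on $X$; $\tilde X=X\cup X^{-1}$ with $X^{-1}=\{x^{-1}:x\in X\}$ a disjoint copy of $X$; $\pi:\tilde X^*\to \mathrm{FIM}_X$ is the canonical surjective homomorphism; $\ell(w)$ is the length of the word $w$. For $\mathcal{K}\in\{\mathcal{R},\mathcal{L}\}$ the corresponding Green's relation on $\mathrm{FIM}_X$, $$\mathcal{K}\text{-}\mathrm{Geo}(\mathrm{FIM}_X)=\bigl\{w\in\tilde X^*: \ell(w)=\min\{\ell(u): u\in\tilde X^*,\ (u\pi)\,\mathcal{K}\,(w\pi)\}\bigr\}.$$ For a word $w=y_1\cdots y_n$ with $y_i\in\tilde X$, the formal inverse is $w^{-1}=y_n^{-1}\cdots y_1^{-1}$ (with $(x^{-1})^{-1}=x$), and for a language $K\subseteq\tilde X^*$, $K^{-1}=\{w^{-1}:w\in K\}$. *)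

(* Defs.v *)
From HB Require Import structures.
From mathcomp Require Import all_boot.
From mathcomp Require Import generic_quotient boolp classical_sets.

Set Implicit Arguments.
Unset Strict Implicit.
Unset Printing Implicit Defensive.

Local Open Scope quotient_scope.
Local Open Scope classical_set_scope.

(* [inl x] is the letter x and [inr x] its formal inverse. *)
Definition letter (X : finType) : finType := (X + X)%type.

Definition word (X : finType) : choiceType := seq (letter X).

Section FreeInverseMonoid.
Variable X : finType.
Implicit Types (y : letter X) (u v w : word X).

Definition linv y : letter X :=
  match y with inl x => inr x | inr x => inl x end.

Definition winv w : word X := rev (map linv w).

(* The Vagner congruence: the least monoid congruence on words containing the
   pairs (u u^-1 u, u) and (u u^-1 v v^-1, v v^-1 u u^-1). *)
Inductive vagner : word X -> word X -> Prop :=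
| vagner_regular u : vagner (u ++ winv u ++ u) u
| vagner_idemC u v :
    vagner (u ++ winv u ++ v ++ winv v) (v ++ winv v ++ u ++ winv u)
| vagner_refl u : vagner u u
| vagner_sym u v : vagner u v -> vagner v u
| vagner_trans u v w : vagner u v -> vagner v w -> vagner u w
| vagner_cat u1 u2 v1 v2 :
    vagner u1 u2 -> vagner v1 v2 -> vagner (u1 ++ v1) (u2 ++ v2).

Definition vagnerb : rel (word X) := fun u v => `[< vagner u v >].

Lemma vagnerb_refl : reflexive vagnerb.
Proof. by move=> u; apply/asboolP; exact: vagner_refl. Qed.

Lemma vagnerb_sym : symmetric vagnerb.
Proof. by move=> u v; apply/asboolP/asboolP; exact: vagner_sym. Qed.

Lemma vagnerb_trans : transitive vagnerb.
Proof.
by move=> v u w /asboolP uv /asboolP vw; apply/asboolP/(vagner_trans uv vw).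
Qed.

Canonical vagner_equiv :=
  EquivRel vagnerb vagnerb_refl vagnerb_sym vagnerb_trans.

Definition FIM : Type := {eq_quot vagner_equiv}.
HB.instance Definition _ := Choice.on FIM.

Definition fim_pi w : FIM := \pi_({eq_quot vagner_equiv}) w.

Definition fim_repr (a : FIM) : word X := repr (a : {eq_quot vagner_equiv}).

Lemma fim_reprK : cancel fim_repr fim_pi.
Proof. by move=> a; exact: reprK. Qed.

Lemma fim_piP u v : fim_pi u = fim_pi v <-> vagner u v.
Proof.
split=> [/eqmodP/asboolP // | uv].
by apply/eqmodP/asboolP.
Qed.

Lemma fim_pi_surj (a : FIM) : exists w, fim_pi w = a.
Proof. by exists (fim_repr a); exact: fim_reprK. Qed.

Definition fim_mul (a b : FIM) : FIM := fim_pi (fim_repr a ++ fim_repr b).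
Definition fim_one : FIM := fim_pi [::].

Lemma fim_pi_cat u v : fim_pi (u ++ v) = fim_mul (fim_pi u) (fim_pi v).
Proof.
by apply/fim_piP/vagner_cat; apply/fim_piP; rewrite fim_reprK.
Qed.

Lemma fim_mulA : associative fim_mul.
Proof.
move=> a b c; rewrite -(fim_reprK a) -(fim_reprK b) -(fim_reprK c).
by rewrite -!fim_pi_cat catA.
Qed.

Lemma fim_mul1 : left_id fim_one fim_mul.
Proof. by move=> a; rewrite -(fim_reprK a) -fim_pi_cat. Qed.

Lemma fim_mulr1 : right_id fim_one fim_mul.
Proof. by move=> a; rewrite -(fim_reprK a) -fim_pi_cat cats0. Qed.

HB.instance Definition _ := isMonoid.Build FIM fim_mulA fim_mul1 fim_mulr1.

End FreeInverseMonoid.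

Section Green.
Local Open Scope group_scope.
Variable M : monoidType.

(* As M has a unit, the principal right and left ideals generated by [a] are
   [aM] and [Ma]. *)
Definition greenR (a b : M) : Prop :=
  [set a * s | s in [set: M]] = [set b * s | s in [set: M]].

Definition greenL (a b : M) : Prop :=
  [set s * a | s in [set: M]] = [set s * b | s in [set: M]].

End Green.

Definition is_min (A : set nat) (m : nat) : Prop :=
  A m /\ forall k, A k -> m <= k.

Definition Geo (X : finType) (K : FIM X -> FIM X -> Prop) : set (word X) :=
  [set w | is_min [set size u | u in [set u : word X | K (fim_pi u) (fim_pi w)]]
                  (size w)].

Definition lang_inv (X : finType) (L : set (word X)) : set (word X) :=
  [set winv w | w in L].

(* Main.v *)
Require Import Defs.
From mathcomp Require Import all_boot.
From mathcomp Require Import classical_sets.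

(** The Vagner congruence is stable under formal inversion of words: inversion
    sends the pair (u u^-1 u, u) to the pair of the same shape for u^-1, and it
    swaps the two sides of (u u^-1 v v^-1, v v^-1 u u^-1).  Formal inversion
    therefore descends to an involutive anti-automorphism of FIM_X
    ([vagner_winv], [fim_invM], [fim_invK]).  Any such map exchanges principal
    right ideals with principal left ideals, hence Green's relations R and L
    ([greenR_anti], [greenL_anti]).  On words it preserves length, so it carries
    the words of minimal length in an R-class to those of minimal length in the
    corresponding L-class ([Geo_winv]). *)

Set Implicit Arguments.
Unset Strict Implicit.
Unset Printing Implicit Defensive.

Local Open Scope classical_set_scope.

Section AntiAutomorphism.
Local Open Scope group_scope.
Variables (M : monoidType) (f : M -> M).
Hypothesis fM : forall a b, f (a * b) = f b * f a.
Hypothesis fK : involutive f.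

Lemma image_right_ideal a :
  f @` [set a * s | s in [set: M]] = [set s * f a | s in [set: M]].
Proof.
rewrite eqEsubset; split=> [_ [_ [s _ <-] <-]|_ [s _ <-]].
  by exists (f s) => //; rewrite fM.
by exists (a * f s); [exists (f s)|rewrite fM fK].
Qed.

Lemma image_left_ideal a :
  f @` [set s * a | s in [set: M]] = [set f a * s | s in [set: M]].
Proof.
rewrite eqEsubset; split=> [_ [_ [s _ <-] <-]|_ [s _ <-]].
  by exists (f s) => //; rewrite fM.
by exists (f s * a); [exists (f s)|rewrite fM fK].
Qed.

Lemma greenR_anti a b : greenR a b -> greenL (f a) (f b).
Proof.
by rewrite /greenR /greenL => eq_ab; rewrite -!image_right_ideal eq_ab.
Qed.

Lemma greenL_anti a b : greenL a b -> greenR (f a) (f b).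
Proof.
by rewrite /greenR /greenL => eq_ab; rewrite -!image_left_ideal eq_ab.
Qed.

End AntiAutomorphism.

Section FormalInverse.
Variable X : finType.
Implicit Types (u v w : word X) (a b : FIM X).

Lemma linvK : involutive (@linv X).
Proof. by case. Qed.

Lemma winvK : involutive (@winv X).
Proof. by move=> w; rewrite /winv map_rev revK (mapK linvK). Qed.

Lemma winv_cat u v : winv (u ++ v) = winv v ++ winv u.
Proof. by rewrite /winv map_cat rev_cat. Qed.

Lemma size_winv w : size (winv w) = size w.
Proof. by rewrite size_rev size_map. Qed.

Lemma vagner_winv u v : vagner u v -> vagner (winv u) (winv v).
Proof.
elim=> {u v} [u|u v|u|u v _|u v w _ uv _|u1 u2 v1 v2 _ u12 _ v12].
- rewrite !winv_cat -catA; exact: vagner_regular.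
- rewrite !winv_cat !winvK -!catA; exact: vagner_idemC.
- exact: vagner_refl.
- exact: vagner_sym.
- exact: vagner_trans.
- rewrite !winv_cat; exact: vagner_cat.
Qed.

Definition fim_inv a : FIM X := fim_pi (winv (fim_repr a)).

Lemma fim_inv_pi w : fim_inv (fim_pi w) = fim_pi (winv w).
Proof. by apply/fim_piP/vagner_winv/fim_piP; rewrite fim_reprK. Qed.

Lemma fim_invK : involutive fim_inv.
Proof. by move=> a; rewrite -(fim_reprK a) !fim_inv_pi winvK. Qed.

Lemma fim_invM a b : fim_inv (a * b)%g = (fim_inv b * fim_inv a)%g.
Proof.
rewrite -(fim_reprK a) -(fim_reprK b).
rewrite -[(fim_pi _ * fim_pi _)%g]fim_pi_cat !fim_inv_pi winv_cat.
exact: fim_pi_cat.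
Qed.

(** Stated for two abstract relations exchanged by the anti-automorphism, so
    that it serves both for passing from R to L and for passing back. *)
Lemma Geo_winv (K K' : FIM X -> FIM X -> Prop) w :
    (forall a b, K a b -> K' (fim_inv a) (fim_inv b)) ->
    (forall a b, K' a b -> K (fim_inv a) (fim_inv b)) ->
  Geo K w -> Geo K' (winv w).
Proof.
move=> KK' K'K [[u Kuw size_u] min_w]; rewrite /Geo /is_min /= size_winv; split.
  exists (winv u); last by rewrite size_winv.
  by rewrite /= -!fim_inv_pi; apply: KK'.
move=> _ [v K'vw <-]; apply: min_w; exists (winv v); last by rewrite size_winv.
by rewrite /= -(winvK w) -!fim_inv_pi; apply: K'K; rewrite fim_inv_pi.
Qed.

End FormalInverse.

Theorem proposition5p3 (X : finType) :
  Geo (@greenR (FIM X)) = lang_inv (Geo (@greenL (FIM X))).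
Proof.
have RL := greenR_anti (@fim_invM X) (@fim_invK X).
have LR := greenL_anti (@fim_invM X) (@fim_invK X).
rewrite eqEsubset; split=> [w geo_w|_ [w geo_w <-]]; last exact: Geo_winv geo_w.
by exists (winv w); [exact: Geo_winv geo_w|rewrite winvK].
Qed.
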